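(* Let $\sigma$ be a Cayley permutation of length $k$ and let $\alpha_1,\ldots,\alpha_k$ be nonempty Cayley permutations for which the inflation $\sigma[\alpha_1,\ldots,\alpha_k]$ is defined (i.e. $\alpha_i=1$ whenever $|\sigma^{-1}(\sigma(i))|>1$). Then $\sigma[\alpha_1,\ldots,\alpha_k]$ is a restricted growth function if and only if $\sigma,\alpha_1,\ldots,\alpha_k$ are all restricted growth functions.
   Context: Write $[n]=\{1,\ldots,n\}$. A Cayley permutation of length $n$ is a word $\omega=w_1\cdots w_n$ of positive integers whose set of letters is $[m]$ for some $m\leq n$; equivalently a map $\omega:[n]\to[n]$, $\omega(i)=w_i$, with image $[m]$, and $\max(\omega)=m$. Inflation: let $\sigma$ be a Cayley permutation of length $k$ and let $\alpha_1,\ldots,\alpha_k$ be nonempty Cayley permutations with $\alpha_i=1$ (the one-letter word) whenever $|\sigma^{-1}(\sigma(i))|>1$. Put $h_j=\max(\alpha_i)$ if $\sigma^{-1}(j)=\{i\}$ and $h_j=1$ if $|\sigma^{-1}(j)|>1$. The inflation $\sigma[\alpha_1,\ldots,\alpha_k]$ is the Cayley permutation obtained from $\sigma$ by replacing each entry $\sigma(i)$ by the word $\alpha_i$ with $h_1+\cdots+h_{\sigma(i)-1}$ added to each letter. For example $312143[1,1,221,1,12,1]=413321564$. A Cayley permutation $w_1\cdots w_n$ is a restricted growth function (RGF) if $w_1=1$ and $w_{i+1}\leq\max(w_1,\ldots,w_i)+1$ for $1\leq i<n$. *)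

(* Defs.v *)
From mathcomp Require Import all_boot.

Set Implicit Arguments.
Unset Strict Implicit.
Unset Printing Implicit Defensive.

(* Words are sequences of naturals. Letters are positive integers, as usual,
   but positions are numbered from 0: the i-th letter of w, counted from 1, is
   nth 0 w i.-1. *)

Definition maxw (w : seq nat) : nat := \max_(x <- w) x.

Definition cayley (w : seq nat) : Prop :=
  exists2 m, m <= size w & forall x, (x \in w) = (1 <= x <= m).

(* The empty word is a Cayley permutation, but it has no first letter, hence it
   is not a restricted growth function. *)
Definition rgf (w : seq nat) : Prop :=
  [/\ cayley w,
      0 < size w,
      nth 0 w 0 = 1
    & forall i, i.+1 < size w -> nth 0 w i.+1 <= maxw (take i.+1 w) + 1].

Definition inflatable (sigma : seq nat) (alpha : seq (seq nat)) : Prop :=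
  [/\ cayley sigma,
      size alpha = size sigma,
      forall i, i < size sigma ->
        cayley (nth [::] alpha i) /\ nth [::] alpha i <> [::]
    & forall i, i < size sigma -> 1 < count_mem (nth 0 sigma i) sigma ->
        nth [::] alpha i = [:: 1]].

(* The number h_j of values of the inflation that come from the letter j. When
   j occurs exactly once in sigma, index j sigma is its position. *)
Definition height (sigma : seq nat) (alpha : seq (seq nat)) (j : nat) : nat :=
  if count_mem j sigma == 1 then maxw (nth [::] alpha (index j sigma)) else 1.

Definition inflation (sigma : seq nat) (alpha : seq (seq nat)) : seq nat :=
  flatten
    (mkseq (fun i => [seq x + \sum_(1 <= j < nth 0 sigma i) height sigma alpha j
                     | x <- nth [::] alpha i])
           (size sigma)).

Example inflation_example :
  inflation [:: 3; 1; 2; 1; 4; 3]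
            [:: [:: 1]; [:: 1]; [:: 2; 2; 1]; [:: 1]; [:: 1; 2]; [:: 1]]
  = [:: 4; 1; 3; 3; 2; 1; 5; 6; 4].
Proof. by rewrite /inflation /height /maxw unlock. Qed.

(* Main.v *)
(* A word of positive integers is a restricted growth function exactly when every
   letter smaller than a given entry already occurs before that entry.  A letter of
   the inflation is uniquely a + H(t), with t a letter of sigma, H(t) the sum of the
   heights below t and 1 <= a <= h_t.  The letters below an entry a + H(s) of
   block i are thus those coming from letters t < s of sigma, whose earlier presence
   is the growth condition on sigma, and those b + H(s) with b < a.  The latter are
   found in block i itself: when a > 1, alpha_i is not the one-letter word, so
   s occurs only once in sigma. *)
Require Import Defs.
From mathcomp Require Import all_boot zify.

(** * Growth of words as a condition on earlier letters *)

Definition grows_from (s w : seq nat) : Prop :=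
  forall i, i < size w -> forall y, 0 < y < nth 0 w i -> y \in s ++ take i w.

(** The prefix [s] in [grows_from] holds the letters already read; carrying it along is what lets
    the condition split over a concatenation, and later block by block. *)
Lemma grows_from_cat (s w1 w2 : seq nat) :
  grows_from s (w1 ++ w2) <-> grows_from s w1 /\ grows_from (s ++ w1) w2.
Proof.
split=> [gr | [gr1 gr2] i].
  split=> i lti y.
    have := gr i; rewrite size_cat nth_cat take_cat lti.
    by apply; apply: ltn_addr.
  have := gr (size w1 + i).
  rewrite size_cat ltn_add2l nth_cat take_cat.
  by rewrite [size w1 + i < _]ltnNge leq_addr /= addKn -catA; apply.
rewrite size_cat nth_cat take_cat; case: (ltnP i (size w1)) => [lti _ | le_i lti] y.
  exact: gr1.
by rewrite catA; apply: gr2; rewrite ltn_subLR.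
Qed.

Lemma grows_from_flatten (s : seq nat) (ws : seq (seq nat)) :
  grows_from s (flatten ws) <->
  forall i, i < size ws -> grows_from (s ++ flatten (take i ws)) (nth [::] ws i).
Proof.
elim: ws s => [|w ws IH] s /=; first by split=> // _ [].
rewrite grows_from_cat IH; split=> [[gr grs] [|i] //= lti | gr].
- by rewrite cats0.
- by rewrite catA; apply: grs.
- split=> [|i lti]; first by have := gr 0 isT; rewrite /= cats0.
  by rewrite -catA; apply: (gr i.+1).
Qed.

Lemma leq_maxw (x : nat) (w : seq nat) : x \in w -> x <= maxw w.
Proof. by move=> xw; apply: (leq_bigmax_seq (F := id)). Qed.

Lemma maxw_mem (w : seq nat) : 0 < size w -> maxw w \in w.
Proof.
elim: w => // x [|y w] IH _; first by rewrite /maxw big_seq1 mem_head.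
rewrite /maxw big_cons -/(maxw _) inE /maxn; case: ifP => _; last by rewrite eqxx.
by rewrite IH ?orbT.
Qed.

Lemma cayleyE (w : seq nat) :
  cayley w -> forall x, (x \in w) = (0 < x <= maxw w).
Proof.
case=> m _ wE x; rewrite wE; case: w wE => [|z w] wE.
  (* For the empty word [m] must be 0, as a positive [m] would itself be a letter. *)
  have: (m \in [::]) = (0 < m <= m) := wE m.
  by rewrite in_nil leqnn andbT /maxw big_nil; lia.
have := wE (maxw (z :: w)); rewrite maxw_mem // => /esym /andP[_ le_m].
have /andP[z_gt0 le_zm]: 0 < z <= m by rewrite -wE mem_head.
have: m \in z :: w by rewrite wE leqnn (leq_trans z_gt0).
by move/leq_maxw=> le_mw; congr (_ && (_ <= _)); apply/eqP; rewrite eqn_leq le_mw.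
Qed.

(** Growth at the first occurrence of the maximum puts every smaller positive letter before it.
    These distinct letters also bound the maximum by the length. *)
Lemma growing_cayley (w : seq nat) :
  all (leq 1) w -> grows_from [::] w -> cayley w.
Proof.
move=> /allP w_gt0 gr.
have wE x : (x \in w) = (0 < x <= maxw w).
  apply/idP/andP => [xw | [x_gt0]]; first by rewrite w_gt0 ?leq_maxw.
  case: (posnP (size w)) => [/size0nil -> | szw].
    by rewrite /maxw big_nil leqNgt x_gt0.
  have mw := maxw_mem _ szw.
  rewrite leq_eqVlt => /orP[/eqP -> // | lt_xm].
  apply: mem_take (gr (index (maxw w) w) _ x _); first by rewrite index_mem.
  by rewrite nth_index // x_gt0.
exists (maxw w) => //.
rewrite -(size_iota 1 (maxw w)); apply: uniq_leq_size (iota_uniq _ _) _ => x.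
by rewrite mem_iota wE add1n ltnS.
Qed.

(** Steps of at most one above the running maximum leave no gap, so each prefix contains all values
    up to its maximum ([mem_prefix]). Conversely, a larger step would skip the running maximum plus
    one, and a first letter above 1 would need an earlier 1. *)
Lemma rgfP (w : seq nat) :
  rgf w <-> [/\ 0 < size w, all (leq 1) w & grows_from [::] w].
Proof.
split=> [[cw szw w0 wS] | [szw w_gt0 gr]].
  have pos : all (leq 1) w by apply/allP=> x; rewrite (cayleyE _ cw) => /andP[].
  have mem_prefix i y : i <= size w -> 0 < y <= maxw (take i w) -> y \in take i w.
    elim: i y => [|i IH] y lti; first by rewrite take0 /maxw big_nil; lia.
    rewrite (take_nth 0) // mem_rcons inE /maxw -cats1 big_cat big_seq1 /=.
    rewrite -/(maxw _) => /andP[y_gt0 le_y].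
    have [le_ym | lt_my] := leqP y (maxw (take i w)).
      by rewrite IH ?orbT ?y_gt0 // ltnW.
    suff -> : y = nth 0 w i by rewrite eqxx.
    (* The empty prefix has maximum 0, so at position 0 the bound comes from [w0] instead of
       [wS]. *)
    case: i lti {IH} le_y lt_my => [|i] lti.
      by rewrite take0 /maxw big_nil w0; lia.
    by have := wS i lti; lia.
  split=> // -[|i] lti y; first by rewrite w0; lia.
  move=> /andP[y_gt0 lt_y]; apply: mem_prefix; first exact: ltnW.
  by have := wS i lti; lia.
split=> //; first exact: growing_cayley.
  have := gr 0 szw 1; have := all_nthP 0 w_gt0 0 szw.
  by rewrite take0; case: (nth 0 w 0) => [|[|n]] // _ /(_ isT).
move=> i lti; rewrite leqNgt; apply/negP => lt_max.
have := gr i.+1 lti (maxw (take i.+1 w) + 1).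
rewrite lt_max addn1 => /(_ isT) /leq_maxw.
by rewrite ltnn.
Qed.

(** * Unique decomposition of values along consecutive intervals *)

Section Offset.

Variable f : nat -> nat.
Let offset s := \sum_(1 <= j < s) f j.

Lemma offset_lt (t s : nat) : 0 < t < s -> f t + offset t <= offset s.
Proof.
move=> /andP[t_gt0 lt_ts]; rewrite /offset (big_cat_nat t_gt0 (ltnW lt_ts)) /=.
by rewrite (big_ltn lt_ts) addnC leq_add2l leq_addr.
Qed.

(** The intervals [(offset t, offset t + f t]] lie end to end and tile [(0, offset s]]; the
    induction asks whether [y] falls in the last one. *)
Lemma offset_decomp (y s : nat) : 0 < y <= offset s ->
  exists t a, [/\ 0 < t < s, 0 < a <= f t & y = a + offset t].
Proof.
elim: s => [|[|s] IH]; rewrite /offset; try by rewrite big_geq //; lia.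
rewrite big_nat_recr //= -/(offset _) => /andP[y_gt0 le_y].
have [le_ys | lt_sy] := leqP y (offset s.+1).
  have [|t [a [/andP[t_gt0 lt_ts] a_bd ->]]] := IH; first by rewrite y_gt0.
  by exists t, a; split=> //; rewrite t_gt0 ltnW.
by exists s.+1, (y - offset s.+1); split; rewrite -/(offset _); lia.
Qed.

(** Intervals of different letters are disjoint, by [offset_lt], so a value determines the letter it
    comes from. *)
Lemma offset_inj (s t a b : nat) :
  0 < s -> 0 < t -> 0 < a <= f s -> 0 < b <= f t ->
  a + offset s = b + offset t -> s = t.
Proof.
move=> s_gt0 t_gt0 a_bd b_bd eq_ab; case: (ltngtP s t) => // lt.
  by have := offset_lt s t; rewrite s_gt0 lt => /(_ isT); lia.
by have := offset_lt t s; rewrite t_gt0 lt => /(_ isT); lia.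
Qed.

End Offset.

Lemma count_mem_gt1 (T : eqType) (x0 : T) (w : seq T) (j i : nat) :
  j < i -> i < size w -> nth x0 w j = nth x0 w i ->
  1 < count_mem (nth x0 w i) w.
Proof.
move=> lt_ji lti eq_ji; rewrite -[X in count_mem _ X](cat_take_drop i) count_cat.
rewrite (drop_nth x0 lti) /= eqxx addnCA add1n ltnS addn_gt0 -has_count has_pred1.
by rewrite -eq_ji -(nth_take x0 lt_ji) mem_nth // size_take lti.
Qed.

(** * Letters and growth of the inflation *)

Section Inflation.

Variables (sigma : seq nat) (alpha : seq (seq nat)).
Hypothesis hinfl : inflatable sigma alpha.

Local Notation sg i := (nth 0 sigma i).
Local Notation al i := (nth [::] alpha i).
Local Notation h := (height sigma alpha).
Local Notation offset s := (\sum_(1 <= j < s) h j).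
Local Notation block i := [seq x + offset (sg i) | x <- al i].

Lemma sigma_gt0 (i : nat) : i < size sigma -> 0 < sg i.
Proof.
by case: hinfl => cs _ _ _ /(mem_nth 0); rewrite (cayleyE _ cs) => /andP[].
Qed.

Lemma sigma_lt_mem (i t : nat) : i < size sigma -> 0 < t < sg i -> t \in sigma.
Proof.
case: hinfl => cs _ _ _ /(mem_nth 0); rewrite !(cayleyE _ cs).
by move=> /andP[_ le_m] /andP[-> lt_t]; apply: leq_trans (ltnW lt_t) le_m.
Qed.

Lemma size_alpha_gt0 (i : nat) : i < size sigma -> 0 < size (al i).
Proof. by case: hinfl => _ _ ca _ /ca[_]; case: (al i). Qed.

Lemma alpha_repeated (i j : nat) :
  j < i -> i < size sigma -> sg j = sg i -> al i = [:: 1].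
Proof.
move=> lt_ji lti eq_ji; case: hinfl => _ _ _; apply=> //.
exact: count_mem_gt1 _ _ _ _ _ lt_ji lti eq_ji.
Qed.

(** This merges the two cases of [height]: a repeated letter has block [[:: 1]] and height 1, while
    for a letter occurring once [index] returns [i] and the height is the maximum of [al i]. *)
Lemma mem_alpha (i a : nat) :
  i < size sigma -> (a \in al i) = (0 < a <= h (sg i)).
Proof.
move=> lti; case: hinfl => _ _ ca al1; rewrite /height.
have sgi := mem_nth 0 lti.
case: eqP => [c1 | cn1]; last first.
  have c_gt1 : 1 < count_mem (sg i) sigma.
    by move: sgi cn1; rewrite -has_pred1 has_count; case: (count_mem _ _) => [|[]].
  by rewrite al1 // mem_seq1 andbC -eqn_leq.
suff -> : index (sg i) sigma = i by apply: cayleyE; case: (ca i lti).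
have lt_idx : index (sg i) sigma < size sigma by rewrite index_mem.
have [lt|lt|//] := ltngtP (index (sg i) sigma) i.
  by have := count_mem_gt1 _ _ _ _ _ lt lti (nth_index 0 sgi); rewrite c1.
by have := before_find 0 lt; rewrite /= eqxx.
Qed.

Lemma height_gt0 (t : nat) : t \in sigma -> 0 < h t.
Proof.
move=> /(nthP 0)[i lti <-]; have := mem_nth 0 (size_alpha_gt0 _ lti).
by rewrite mem_alpha // => /andP[]; apply: leq_trans.
Qed.

Lemma mem_blocks (i y : nat) : i <= size sigma ->
  reflect (exists2 j, j < i & y \in block j)
          (y \in flatten (take i (mkseq (fun j => block j) (size sigma)))).
Proof.
move=> le_i; have -> : take i (mkseq (fun j => block j) (size sigma)) =
  mkseq (fun j => block j) i by rewrite /mkseq -map_take take_iota (minn_idPl le_i).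
apply: (iffP flatten_mapP) => -[j]; first by rewrite mem_iota => lt_ji; exists j.
by move=> lt_ji yj; exists j; rewrite // mem_iota.
Qed.

Lemma inflation_gt0 : all (leq 1) (inflation sigma alpha).
Proof.
apply/allP=> y /flatten_mapP[i]; rewrite mem_iota => lti /mapP[x].
by rewrite mem_alpha // => /andP[x_gt0 _] ->; rewrite addn_gt0 x_gt0.
Qed.

Lemma size_inflation_gt0 : (0 < size (inflation sigma alpha)) = (0 < size sigma).
Proof.
rewrite /inflation; case: sigma hinfl size_alpha_gt0 => // z s _ /(_ 0 isT) al0.
by rewrite /mkseq /= size_cat size_map addn_gt0 al0.
Qed.

Lemma inflation_growsP :
  grows_from [::] (inflation sigma alpha) <->
  forall i p y, i < size sigma -> p < size (al i) ->
    0 < y < nth 0 (al i) p + offset (sg i) ->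
    (exists2 j, j < i & y \in block j) \/
    y \in [seq x + offset (sg i) | x <- take p (al i)].
Proof.
rewrite /inflation grows_from_flatten size_mkseq.
split=> gr i.
  move=> p y lti ltp y_bd; have := gr i lti p.
  rewrite nth_mkseq // size_map (nth_map 0) // -map_take.
  by move=> /(_ ltp y y_bd); rewrite mem_cat => /orP[/(mem_blocks _ _ (ltnW lti)) | ]; auto.
move=> lti p; rewrite nth_mkseq // size_map => ltp y; rewrite (nth_map 0) //.
move=> /gr[] // yP; rewrite mem_cat -map_take; apply/orP; last by right.
by left; apply/mem_blocks; first exact: ltnW.
Qed.

End Inflation.

Theorem lemma6p2 (sigma : seq nat) (alpha : seq (seq nat))
    (hinfl : inflatable sigma alpha) :
  rgf (inflation sigma alpha) <->
  (rgf sigma /\ forall i, i < size sigma -> rgf (nth [::] alpha i)).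
Proof.
have sg_gt0 := sigma_gt0 _ _ hinfl.
have al_mem := mem_alpha _ _ hinfl.
have al_gt0 := size_alpha_gt0 _ _ hinfl.
have growsP := inflation_growsP sigma alpha.
rewrite rgfP size_inflation_gt0 //.
split=> [[szs _ /growsP gr] | [/rgfP[szs _ grs] gra]]; last first.
  split=> //; first exact: inflation_gt0.
  apply/growsP=> i p y lti ltp /andP[y_gt0 lt_y].
  (* A value above the offset comes from the letter at [i] itself, and growth of [al i] supplies it
     within the block. *)
  have [lt_oy | le_yo] := ltnP (\sum_(1 <= j < nth 0 sigma i) height sigma alpha j) y.
    have /rgfP[_ _ /(_ p ltp) gri] := gra i lti.
    right; rewrite -(subnK (ltnW lt_oy)) (mem_map (@addIn _)).
    by apply: gri; rewrite subn_gt0 lt_oy ltn_subLR 1?addnC // ltnW.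
  have [|t [a [t_bd a_bd ->]]] := offset_decomp (height sigma alpha) y (nth 0 sigma i).
    by rewrite y_gt0.
  left; have /(nthP 0)[j] := grs i lti t t_bd.
  rewrite size_take lti => ltj; rewrite nth_take // => sgj.
  have ltjs := ltn_trans ltj lti.
  by exists j => //; rewrite sgj (mem_map (@addIn _)) al_mem // sgj.
split=> [|i lti].
  apply/rgfP; split=> //; first by apply/(all_nthP 0).
  move=> i lti t t_bd /=; have t_mem := sigma_lt_mem _ _ hinfl _ _ lti t_bd.
  have h_gt0 := height_gt0 _ _ hinfl _ t_mem.
  (* The least value coming from [t] lies below the first letter of block [i]. At position 0 nothing
     of block [i] has been read, so that value lies in an earlier block, which must be a block of
     [t]. *)
  have [||[j ltj]|] := gr i 0 (1 + \sum_(1 <= j < t) height sigma alpha j) lti.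
  - exact: al_gt0.
  - have := mem_nth 0 (al_gt0 i lti); rewrite al_mem // => /andP[a_gt0 _].
    rewrite -addnS leq_add // (leq_trans _ (offset_lt (height sigma alpha) _ _ t_bd)) //.
    by rewrite -add1n leq_add2r.
  - have ltjs := ltn_trans ltj lti.
    move=> /mapP[x]; rewrite al_mem // => x_bd /offset_inj -> //; last first.
    + exact: sg_gt0.
    + by case/andP: t_bd.
    by rewrite -(nth_take 0 ltj) mem_nth // size_take lti.
  - by rewrite take0.
apply/rgfP; split; first exact: al_gt0.
  by apply/allP=> x; rewrite al_mem // => /andP[].
move=> p ltp a a_bd /=.
have [|[j ltj]|] := gr i p (a + \sum_(1 <= j < nth 0 sigma i) height sigma alpha j) lti ltp.
- by rewrite ltn_add2r; lia.
- have ltjs := ltn_trans ltj lti.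
  have := mem_nth 0 ltp; rewrite al_mem // => /andP[_ le_h].
  move=> /mapP[x]; rewrite al_mem // => x'_bd /offset_inj eq_ij.
  (* If the value were in an earlier block, the letter at [i] would be repeated; then [al i] is
     [[:: 1]], which has no entry above a positive [a]. *)
  have eqji : nth 0 sigma j = nth 0 sigma i.
    apply/esym/eq_ij => //; try exact: sg_gt0.
    by have /andP[-> /ltnW lt_a] := a_bd; apply: leq_trans lt_a le_h.
  move: ltp a_bd; rewrite (alpha_repeated _ _ hinfl _ _ ltj lti eqji).
  by case: p {le_h} => // _; case: a {eq_ij} => [|[]].
- by move=> /mapP[x x_mem /addIn ->].
Qed.
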